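(* For every $c>0$ and every sufficiently large $d$ (that is, there is $d_0=d_0(c)$ such that for every $d\geq d_0$), the following holds for every $n$-vertex graph $G$. Either $G$ contains a cycle of length at least $d$, or one can delete at most $cdn$ edges from $G$ to obtain a graph in which every connected component has a vertex-cover of order at most $d$.
   Context: All graphs are finite and simple. A vertex-cover of a graph is a set of vertices meeting every edge. *)

(* Defs.v *)
From HB Require Import structures.
From mathcomp Require Import all_boot all_order all_algebra.
From mathcomp Require Import reals.
Set Implicit Arguments.
Unset Strict Implicit.
Unset Printing Implicit Defensive.

Record sgraph := SGraph {
  vertex :> finType;
  adj : rel vertex;
  adj_sym : symmetric adj;
  adj_irrefl : irreflexive adj
}.

(* An edge is the two-element set of its endpoints, so each edge is counted
   once. *)
Definition edges (G : sgraph) : {set {set G}} :=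
  [set [set p.1; p.2] | p in [pred p : G * G | adj p.1 p.2]].

Section Constructions.
Variable G : sgraph.

Definition del_adj (F : {set {set G}}) : rel G :=
  fun x y => adj x y && ([set x; y] \notin F).

Lemma del_adj_sym (F : {set {set G}}) : symmetric (del_adj F).
Proof. by move=> x y; rewrite /del_adj adj_sym setUC. Qed.

Lemma del_adj_irrefl (F : {set {set G}}) : irreflexive (del_adj F).
Proof. by move=> x; rewrite /del_adj adj_irrefl. Qed.

Definition del_edges (F : {set {set G}}) : sgraph :=
  SGraph (@del_adj_sym F) (@del_adj_irrefl F).

Definition ind_adj (A : {set G}) : rel {x : G | x \in A} :=
  fun x y => adj (val x) (val y).

Lemma ind_adj_sym (A : {set G}) : symmetric (@ind_adj A).
Proof. by move=> x y; rewrite /ind_adj adj_sym. Qed.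

Lemma ind_adj_irrefl (A : {set G}) : irreflexive (@ind_adj A).
Proof. by move=> x; rewrite /ind_adj adj_irrefl. Qed.

Definition induced (A : {set G}) : sgraph :=
  SGraph (@ind_adj_sym A) (@ind_adj_irrefl A).

Definition components : {set {set G}} :=
  [set [set y | connect (@adj G) x y] | x : G].

Definition vertex_cover (S : {set G}) : Prop :=
  forall E : {set G}, E \in edges G -> S :&: E != set0.

(* The bound on the size is needed: path.ucycle also accepts the empty
   sequence and, for an edge xy, the sequence [:: x; y]. *)
Definition graph_cycle (s : seq G) : Prop :=
  2 < size s /\ ucycle (@adj G) s.

End Constructions.

(* Main.v *)
Require Import Defs.
From HB Require Import structures.
From mathcomp Require Import all_boot all_order all_algebra.
From mathcomp Require Import boolp reals zify.
Set Implicit Arguments.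
Unset Strict Implicit.
Unset Printing Implicit Defensive.
Import Order.TTheory GRing.Theory Num.Theory.

(** Let [C] be a longest cycle of [G], of length less than [d], and let [L] be
    a small multiple of [d] and [k] a constant with [d <= k * L].

    If [G - C] has no cycle longer than [2L], then [G - C] has at most [2L]
    edges per vertex ([sparse_of_no_long_cycle]); once they are deleted, [C]
    covers what is left.

    Otherwise [G - C] contains a cycle [D] longer than [2L].  Cut [C] into [k]
    arcs of at most [L] vertices.  Two disjoint paths from one arc [I] to [D]
    avoiding the rest of [C], together with the longer half of [D] between
    their ends, form an ear that replaces part of [I] by more than [L]
    vertices and so gives a cycle longer than [C] ([ear_through_cycle]).
    Menger's theorem for two paths ([menger2]) therefore yields one vertex that
    meets all paths from [I] to [D] off the rest of [C] ([arc_separator]).  The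
    at most [k] vertices obtained in this way separate [C] from [D], because a
    path from [C] to [D] leaves [C] for the last time from some arc
    ([cycle_separator]).

    So [G] splits at a set [S] of at most [k] vertices into two sides that both
    have at least [2k] vertices, as they contain a long cycle each.  Decompose
    both sides recursively, and then detach [S] from one side by deleting the
    edges of that side that still meet [S] ([combine]).  This costs at most
    [k * m], where [m] is the maximum degree left on that side, which may be as
    large as the side itself: a naive count loses a factor [log n].  Detaching
    [S] from the side with the smaller [m] avoids the loss.  For then the
    quantity (number of deleted edges) + [k * m] of the whole is at most the
    sum over the two sides, while the allowance [b * (n - k)] of the whole is
    at least the sum of the allowances, since the sides overlap in at most [k]
    vertices ([decomposition]).  Here [b] is of order [L + k], at most [c * d]
    for large [d].

    Graphs are symmetric relations on a fixed finite type, and deleted edges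
    are counted as ordered pairs of adjacent vertices. *)

(** * Menger's theorem for two paths *)

Section Relations.
Variable T : finType.
Implicit Types (e h : rel T) (W X Y Z D A B S : {set T}).
Implicit Types (x y z : T) (p q r s c : seq T).

Definition arcs e : {set T * T} := [set p | e p.1 p.2].

Definition walk e X D x p := [&& x \in X, path e x p & last x p \in D].

Definition inseparable e X D :=
  forall t, exists x p, walk e X D x p /\ t \notin x :: p.

Definition two_paths e X D :=
  exists x p y q, [/\ walk e X D x p, uniq (x :: p), walk e X D y q,
    uniq (y :: q) & forall z, z \in x :: p -> z \in y :: q -> False].

Lemma walk_uniq e X D x p : walk e X D x p ->
  exists q, [/\ walk e X D x q, uniq (x :: q) & {subset x :: q <= x :: p}].
Proof.
case/and3P=> xX ep lD; case/shortenP: ep lD => q eq uq sq lD.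
by exists q; split=> //; [apply/and3P | move=> z; rewrite !inE;
  case: eqP => //= _ /sq].
Qed.

Lemma two_paths_of_walks e X D x p y q :
  walk e X D x p -> walk e X D y q ->
  (forall z, z \in x :: p -> z \in y :: q -> False) -> two_paths e X D.
Proof.
move=> /walk_uniq [p' [wp up sp]] /walk_uniq [q' [wq uq sq]] dis.
by exists x, p', y, q'; split=> // z /sp zp /sq; apply: dis.
Qed.

Definition rev_rel e : rel T := fun x y => e y x.

Lemma walk_rev e X D x p : walk e X D x p ->
  exists y q, walk (rev_rel e) D X y q /\ y :: q =i x :: p.
Proof.
case/and3P=> xX ep lD; exists (last x p), (rev (belast x p)); split.
  apply/and3P; split=> //; first by rewrite rev_path.
  case: p {ep lD} => [|y p] //=; by rewrite rev_cons last_rcons.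
by move=> z; rewrite -rev_rcons -lastI mem_rev.
Qed.

Lemma inseparable_rev e X D : inseparable e X D -> inseparable (rev_rel e) D X.
Proof.
move=> ins t; have [x [p [/walk_rev [y [q [wq qp]]] tp]]] := ins t.
by exists y, q; rewrite qp.
Qed.

Lemma two_paths_rev e X D : two_paths (rev_rel e) D X -> two_paths e X D.
Proof.
case=> x [p [y [q [/walk_rev [x' [p' [wp ep]]] _ /walk_rev [y' [q' [wq eq]]] _ dis]]]].
by apply: (two_paths_of_walks wp wq) => z; rewrite ep eq; apply: dis.
Qed.

Definition del_arc e x y : rel T := fun u v => e u v && ((u, v) != (x, y)).

Lemma del_arc_path e x y z p :
  x \notin belast z p -> path e z p -> path (del_arc e x y) z p.
Proof.
elim: p z => //= u p IH z; rewrite inE negb_or => /andP[xz xp] /andP[ezu ep].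
by rewrite IH // /del_arc ezu xpair_eqE eq_sym (negPf xz).
Qed.

(** A walk from [X] to [D] avoiding [w] meets [{t, x}]: it either uses the arc
    from [x] to [y], or survives its deletion and contains [t].  Its part up to
    the first meeting has not left [x] yet, hence does not use the arc. *)
Lemma inseparable_del_arc e X D x y t :
  inseparable e X D ->
  (forall z p, walk (del_arc e x y) X D z p -> t \in z :: p) ->
  inseparable (del_arc e x y) X [set t; x].
Proof.
move=> ins sep w; have [z [p [/and3P[zX ep lD] wp]]] := ins w.
case: (boolP (z \in [set t; x])) => [zS|zS].
  exists z, [::]; split; first by rewrite /walk zX zS.
  by move: wp; rewrite !inE negb_or => /andP[].
case: (boolP (has (mem [set t; x]) p)) => [|/hasPn hp]; last first.
  have tp : t \in z :: p.
    apply: sep; rewrite /walk zX lD del_arc_path //.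
    apply/negP => /mem_belast; rewrite inE => /orP[/eqP xz|/hp].
      by move: zS; rewrite -xz !inE eqxx orbT.
    by rewrite /= !inE eqxx orbT.
  by move: tp; rewrite inE => /orP[/eqP tz|/hp]; 
    [move: zS; rewrite -tz|]; rewrite /= !inE eqxx.
move=> hp; move: ep wp {lD}; case: (split_find hp) => u p1 p2 uS /hasPn {}hp ep wp.
have {}uS : u \in [set t; x] := uS.
exists z, (rcons p1 u); split; last first.
  by apply: contra wp; rewrite !inE mem_cat => /orP[->|->]; rewrite ?orbT.
move: ep; rewrite cat_path => /andP[ep _].
rewrite /walk zX last_rcons uS del_arc_path // belast_rcons inE negb_or.
apply/andP; split; first by apply: contra zS => /eqP <-; rewrite !inE eqxx orbT.
by apply/negP => /hp; rewrite /= !inE eqxx orbT.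
Qed.

(** Following [p] as far as [z] and then [q]; the splittings of [p] and [q] are
    part of the conclusion so that a vertex known to lie on the new walk can be
    located on [p] before [z] or on [q] after [z]. *)
Lemma walk_join e X Y Z D x p y q z : walk e X Y x p -> walk e Z D y q ->
  z \in x :: p -> z \in y :: q ->
  exists p1 p2 q1 q2, [/\ p = p1 ++ p2, q = q1 ++ q2, last x p1 = z,
     last y q1 = z & walk e X D x (p1 ++ q2)].
Proof.
move=> /and3P[xX ep _] /and3P[_ eq lD] zp zq.
case/splitPl: zp ep => p1 p2 lz; rewrite cat_path lz => /andP[ep1 _].
case/splitPl: zq eq lD => q1 q2 lz'; rewrite cat_path last_cat lz' => /andP[_ eq2] lD.
by exists p1, p2, q1, q2; split=> //; rewrite /walk xX last_cat cat_path ep1 lz eq2.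
Qed.

(** Goering's induction on the number of arcs.  Delete an arc from [x] to [y].
    If [X] and [D] become separable by a vertex [t], then [X] and [{t, x}] are
    not, nor are [{t, y}] and [D].  The two pairs of paths given by induction,
    one ending in [t] and [x] and the other starting in [t] and [y], can only
    meet in [t], as any other meeting would give a walk avoiding [t].  Gluing
    them at [t] and along the arc gives the two paths.  The vertex [t0] only
    ensures that [T] is inhabited, without which [inseparable] holds vacuously. *)
Lemma menger2 (t0 : T) e X D : inseparable e X D -> two_paths e X D.
Proof.
move: {2}#|arcs e| (leqnn #|arcs e|) => n.
elim: n e X D => [|n IH] e X D le_n ins.
  have e0 x y : e x y = false.
    apply/negP => exy; have : (x, y) \in arcs e by rewrite inE.
    by move: le_n; rewrite leqn0 => /eqP/cards0_eq ->; rewrite inE.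
  have nil_walk t : exists x, (x \in X :&: D) && (t != x).
    have [x [p [/and3P[xX ep lD] tp]]] := ins t; exists x.
    case: p ep lD tp => [|y p] /=; last by rewrite e0.
    by rewrite !inE xX => _ ->.
  have [x /andP[xXD _]] := nil_walk t0; have [y /andP[yXD xy]] := nil_walk x.
  move: xXD yXD; rewrite !inE => /andP[xX xD] /andP[yX yD].
  apply: (@two_paths_of_walks _ _ _ x [::] y [::]).
  - by rewrite /walk /= xX.
  - by rewrite /walk /= yX.
  by move=> z; rewrite !inE => /eqP -> /eqP E; rewrite E eqxx in xy.
have [le_n'|lt_n] := leqP #|arcs e| n; first exact: IH.
have /card_gt0P [[x y]] : 0 < #|arcs e| by apply: leq_ltn_trans lt_n.
rewrite inE /= => exy; set e' := del_arc e x y.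
have sub' : subrel e' e by move=> u v /andP[].
have le_e' : #|arcs e'| <= n.
  rewrite -ltnS; apply: leq_trans le_n; apply/proper_card/properP; split.
    by apply/subsetP => p; rewrite !inE => /sub'.
  by exists (x, y); rewrite !inE // /e' /del_arc /= eqxx andbF.
have walk' U V z p : walk e' U V z p -> walk e U V z p.
  by case/and3P=> zU ep lV; apply/and3P; split=> //; apply: sub_path ep.
have [ins'|/existsNP [t /forallNP tsep]] := EM (inseparable e' X D).
  have [x1 [p1 [x2 [p2 [w1 u1 w2 u2 dis]]]]] := IH _ _ _ le_e' ins'.
  by exists x1, p1, x2, p2; split=> //; apply: walk'.
have {}tsep z p : walk e' X D z p -> t \in z :: p.
  move=> wp; apply/negPn/negP => tp; apply: (tsep z).
  by exists p.
have [x1 [p1 P12]] := IH _ _ _ le_e' (inseparable_del_arc ins tsep).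
have /two_paths_rev : two_paths (rev_rel e') D [set t; y].
  have insr : inseparable (del_arc (rev_rel e) y x) D [set t; y].
    apply: inseparable_del_arc (inseparable_rev ins) _ => z p /walk_rev.
    case=> [z' [p' [wp' E]]]; rewrite -E; apply: tsep.
    case/and3P: wp' => zX ep lD; apply/and3P; split=> //.
    apply: sub_path ep => u v; rewrite /rev_rel /e' /del_arc !xpair_eqE.
    by rewrite [(v == y) && _]andbC.
  have eqr : rev_rel e' =2 del_arc (rev_rel e) y x.
    move=> u v; rewrite /rev_rel /e' /del_arc !xpair_eqE.
    by rewrite [(v == x) && _]andbC.
  have le_r : #|arcs (del_arc (rev_rel e) y x)| <= n.
    apply: leq_trans le_e'.
    rewrite -(card_imset (arcs e') (can_inj (@swap_pairK T T))).
    apply/subset_leq_card/subsetP => -[u v]; rewrite inE /= -eqr => euv.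
    by apply/imsetP; exists (v, u); rewrite ?inE.
  have [a [p [b [q [/and3P[aX ep lp] up /and3P[bX eq lq] uq dis]]]]] :=
    IH _ _ _ le_r insr.
  exists a, p, b, q; split=> //; apply/and3P; split=> //.
    by rewrite (eq_path eqr).
  by rewrite (eq_path eqr).
case=> y1 [q1 [y2 [q2 Q12]]].
(* Both ends lie in [{t, x}] and are distinct, so one is [t] and the other [x]. *)
have {x1 p1 P12} [x1 [p1 [x2 [p2 [[w1 u1 w2 u2 dis] l1 l2 nxt]]]]] :
  exists x1 p1 x2 p2, [/\ [/\ walk e' X [set t; x] x1 p1, uniq (x1 :: p1),
     walk e' X [set t; x] x2 p2, uniq (x2 :: p2) &
     forall z, z \in x1 :: p1 -> z \in x2 :: p2 -> False],
     last x1 p1 = t, last x2 p2 = x & t != x].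
  case: P12 => x2 [p2 [w1 u1 w2 u2 dis]].
  have := dis (last x1 p1) (mem_last _ _).
  case/and3P: (w1) => _ _; case/and3P: (w2) => _ _; rewrite !in_set2.
  move=> /orP[] /eqP l2 /orP[] /eqP l1.
  - by rewrite l1 -l2 mem_last => /(_ isT).
  - rewrite l1 => ne; exists x2, p2, x1, p1; split=> //.
      by split=> // z zx zy; apply: (dis z).
    by apply/eqP => tx; rewrite -tx -l2 mem_last in ne; exact: ne.
  - rewrite l1 => ne; exists x1, p1, x2, p2; split=> //.
    by apply/eqP => tx; rewrite tx -l2 mem_last in ne; exact: ne.
  - by rewrite l1 -l2 mem_last => /(_ isT).
have {Q12} [z1 [r1 [r2 [[v1 uv1 v2 uv2 dis'] m1 nty]]]] :
  exists z1 r1 r2, [/\ [/\ walk e' [set t; y] D z1 r1, uniq (z1 :: r1),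
     walk e' [set t; y] D y r2, uniq (y :: r2) &
     forall z, z \in z1 :: r1 -> z \in y :: r2 -> False],
     z1 = t & t != y].
  case: Q12 => v1 uv1 v2 uv2 dis'.
  have ne : y1 != y2.
    by apply/eqP => E; apply: (dis' y1); rewrite ?E mem_head.
  case/and3P: (v1) => + _ _; case/and3P: (v2) => + _ _; rewrite !inE.
  move=> /orP[] /eqP l2' /orP[] /eqP l1'; subst y1 y2; rewrite ?eqxx // in ne.
    exists t, q2, q1; split=> //; last by rewrite eq_sym.
    by split=> // z zx zy; apply: (dis' z).
  by exists t, q1, q2.
subst z1.
have tp2 : t \notin x2 :: p2.
  by apply/negP => tp2; apply: (dis t _ tp2); rewrite -l1 mem_last.
have tr2 : t \notin y :: r2.
  by apply/negP => tr2; apply: (dis' t (mem_head _ _) tr2).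
(* The paths [p1] and [r1] meet the other paths only away from [t]; as [t] is
   the end of [p1] and the start of [r1], it lies neither on the part of [p1]
   before such a meeting nor on the part of [r1] after it. *)
have P1 z : z \in x1 :: p1 -> z \in y :: r2 -> False.
  move=> zp zr; have [a1 [a2 [b1 [b2 [Ep Er la lb wab]]]]] := walk_join w1 v2 zp zr.
  have := tsep _ _ wab; rewrite -cat_cons mem_cat => /orP[ta|tb]; last first.
    by rewrite Er -cat_cons mem_cat tb orbT in tr2.
  move: u1 l1 la; rewrite Ep -cat_cons cat_uniq last_cat.
  case: a2 {Ep} => [|c a2] /and3P[_ nh _] /= lt la; first by
    rewrite -lt la zr in tr2.
  by case/hasP: nh; exists t => //; rewrite -lt mem_last.
have P2 z : z \in x2 :: p2 -> z \in t :: r1 -> False.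
  move=> zp zr; have [a1 [a2 [b1 [b2 [Ep Er la lb wab]]]]] := walk_join w2 v1 zp zr.
  have := tsep _ _ wab; rewrite -cat_cons mem_cat => /orP[ta|tb].
    by rewrite Ep -cat_cons mem_cat ta in tp2.
  by move: uv1; rewrite Er /= mem_cat tb orbT.
have P3 z : z \in x2 :: p2 -> z \in y :: r2 -> False.
  move=> zp zr; have [a1 [a2 [b1 [b2 [Ep Er la lb wab]]]]] := walk_join w2 v2 zp zr.
  have := tsep _ _ wab; rewrite -cat_cons mem_cat => /orP[ta|tb].
    by rewrite Ep -cat_cons mem_cat ta in tp2.
  by rewrite Er -cat_cons mem_cat tb orbT in tr2.
apply: (@two_paths_of_walks _ _ _ x1 (p1 ++ r1) x2 (p2 ++ y :: r2)).
- apply: walk'; case/and3P: w1 => xX ep _; case/and3P: v1 => _ eq lD.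
  by rewrite /walk xX cat_path last_cat ep l1 eq lD.
- case/walk'/and3P: w2 => xX ep _; case/walk'/and3P: v2 => _ eq lD.
  by rewrite /walk xX cat_path last_cat ep l2 /= exy eq lD.
move=> z; rewrite -!cat_cons !mem_cat => /orP[z1|z1] /orP[z2|z2].
- exact: (dis z).
- exact: (P1 z).
- by apply: (P2 z) => //; rewrite inE z1 orbT.
- by apply: (dis' z) => //; rewrite inE z1 orbT.
Qed.

(** Cut a walk at its last vertex in [X] and then at its first vertex in [D]. *)
Lemma walk_trim e X D x p : [disjoint X & D] -> walk e X D x p ->
  exists a r u, [/\ a \in X, u \in D, path e a (rcons r u),
    uniq (a :: rcons r u) /\ {subset a :: rcons r u <= x :: p}
    & forall z, z \in r -> z \notin X :|: D].
Proof.
move=> XD /walk_uniq [q [wq uq sq]].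
suff [a [r [u [aX uD ear [uar sar] rXD]]]] : exists a r u,
    [/\ a \in X, u \in D, path e a (rcons r u),
    uniq (a :: rcons r u) /\ {subset a :: rcons r u <= x :: q}
    & forall z, z \in r -> z \notin X :|: D].
  by exists a, r, u; split=> //; split=> // z /sar /sq.
move: {2}(size q) (leqnn (size q)) => n {p sq}.
elim: n x q wq uq => [|n IH] x q /and3P[xX eq lD] uq.
  case: q eq lD uq => //= _ xD.
  by case/negP: (negbT (disjointFr XD xX)).
case/lastP: q eq lD uq => [_ /= xD|r u]; first by case/negP: (negbT (disjointFr XD xX)).
rewrite last_rcons size_rcons => eq uD uq le_n.
case: (boolP (has (mem (X :|: D)) r)) => [/hasP [z zr zXD]|/hasPn hr]; last first.
  by exists x, r, u; split=> //; split.
case/splitPr: zr eq uq le_n => r1 r2.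
rewrite rcons_cat rcons_cons -cat_rcons cat_path last_rcons.
rewrite -cat_cons cat_uniq size_cat /= => /andP[e1 e2] /and3P[u1 dis u2] le_n.
case/setUP: (zXD : z \in X :|: D) => [zX|zD].
  have [|||a [r' [v [? ? ? [? sar] ?]]]] := IH z (rcons r2 u).
  - by rewrite /walk zX e2 last_rcons.
  - rewrite /= u2 andbT; apply: contra dis => zr; apply/hasP; exists z => //.
    by rewrite /= !inE mem_rcons mem_head orbT.
  - by rewrite size_rcons; lia.
  exists a, r', v; split=> //; split=> // w /sar.
  by rewrite !(inE, mem_cat, mem_rcons) => /or3P[]->; rewrite ?orbT.
have [|||a [r' [v [? ? ? [? sar] ?]]]] := IH x (rcons r1 z).
- by rewrite /walk xX e1 last_rcons.
- by [].
- by rewrite size_rcons; lia.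
exists a, r', v; split=> //; split=> // w /sar.
by rewrite !(inE, mem_cat, mem_rcons) => /or3P[]->; rewrite ?orbT.
Qed.

(** * Longest cycles *)

Definition longest_cycle e s :=
  ucycle e s /\ forall s', ucycle e s' -> size s' <= size s.

Lemma longest_exists (P : pred (seq T)) s0 : P s0 -> (forall s, P s -> uniq s) ->
  exists2 s, P s & forall s', P s' -> size s' <= size s.
Proof.
move=> Ps0 Pu.
pose Q n := [exists t : n.-tuple T, P t].
have exQ : exists n, Q n.
  by exists (size s0); apply/existsP; exists (in_tuple s0).
have bQ n : Q n -> n <= #|T|.
  by case/existsP => t /Pu /card_uniqP; rewrite size_tuple => <-; apply: max_card.
case: (ex_maxnP exQ bQ) => n /existsP [t Pt] max.
exists t => // s' Ps'; rewrite size_tuple; apply: max.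
by apply/existsP; exists (in_tuple s').
Qed.

(** Otherwise [a :: r ++ b :: K] would be a longer cycle. *)
Lemma ear_replacement e a b q K r :
  longest_cycle e (a :: q ++ b :: K) -> path e a (rcons r b) -> uniq r ->
  (forall z, z \in r -> z \notin a :: q ++ b :: K) -> size r <= size q.
Proof.
case=> /andP[ecyc ucyc] max er ur dis.
have : ucycle e (a :: r ++ b :: K).
  apply/andP; split.
    move: ecyc er => /=.
    rewrite !rcons_cat !cat_path [path e a (rcons r b)]rcons_path /=.
    by move=> /and3P[_ _ ->] /andP[-> ->].
  move: ucyc; rewrite /= !cat_uniq !mem_cat !negb_or.
  case/and3P=> /andP[_ aK] uq /and3P[_ uK1 uK2].
  rewrite ur aK /=; apply/and3P; split.
  - by rewrite andbT; apply/negP => /dis; rewrite mem_head.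
  - apply/andP; split.
      by apply/negP => /dis; rewrite inE mem_cat mem_head !orbT.
    by apply/hasPn => z zK; apply/negP => /dis; rewrite !(inE, mem_cat) zK !orbT.
  - by rewrite uK1.
by move/max; rewrite /= !size_cat !ltnS leq_add2r.
Qed.

(** The two arcs of [s] between [u] and [v] have [size s - 2] inner vertices in
    all, so one of them has at least half as many. *)
Lemma long_arc e s u v : symmetric e -> ucycle e s -> u \in s -> v \in s ->
  u != v -> exists q, [/\ path e u (rcons q v), uniq q,
    {subset q <= [predD s & pred2 u v]} & size s <= (size q).*2.+2].
Proof.
move=> sym /andP[cyc us] us' vs uv.
case: (rot_to us') => i s' Es.
have vs' : v \in s'.
  by move: vs; rewrite -(mem_rot i) Es inE eq_sym (negPf uv).
have cs' : cycle e (u :: s') by rewrite -Es rot_cycle.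
have uu : uniq (u :: s') by rewrite -Es rot_uniq.
have ms : s =i u :: s' by move=> z; rewrite -Es mem_rot.
have zs : size s = size (u :: s') by rewrite -Es size_rot.
case/splitPr: vs' cs' uu ms zs {Es} => q1 q2 /=.
rewrite rcons_cat rcons_cons -cat_rcons cat_path last_rcons => /andP[e1 e2].
rewrite mem_cat cat_uniq inE !negb_or -!andbA /=.
case/and5P=> uq1 _ uq2 U1 /and4P[vq1 _ vq2 U2] ms zs.
have [le12|lt12] := leqP (size q2) (size q1).
  exists q1; split=> //; last by rewrite zs size_cat /= -addnn addnS !ltnS leq_add2l.
  move=> z zq; rewrite !inE ms inE mem_cat zq orbT andbT negb_or.
  by apply/andP; split; apply: contraTneq zq => ->.
exists (rev q2); split; rewrite ?rev_uniq //.
- rewrite -rev_cons; have := e2; rewrite -(eq_path (e := fun x y => e y x)) //.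
  by rewrite -rev_path last_rcons belast_rcons.
- move=> z; rewrite mem_rev => zq; rewrite !inE ms inE mem_cat inE zq !orbT andbT negb_or.
  by apply/andP; split; apply: contraTneq zq => ->.
by rewrite size_rev zs size_cat /= -addnn addnS !ltnS leq_add2r ltnW.
Qed.

(** The path to [u], the longer arc of [s] from [u] to [v], and the second path
    backwards form an ear between the vertices [a] and [b] of the longest
    cycle; it cannot have more inner vertices than the segment [I2] that it
    would replace. *)
Lemma ear_through_cycle e I1 I2 I3 J s a r1 u b r2 v : symmetric e ->
  longest_cycle e ((I1 ++ a :: I2 ++ b :: I3) ++ J) -> ucycle e s ->
  (forall z, z \in s -> z \notin (I1 ++ a :: I2 ++ b :: I3) ++ J) ->
  u \in s -> v \in s -> 
  path e a (rcons r1 u) -> uniq (a :: rcons r1 u) ->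
  path e b (rcons r2 v) -> uniq (b :: rcons r2 v) ->
  (forall z, z \in r1 ++ r2 ->
    z \notin s /\ z \notin (I1 ++ a :: I2 ++ b :: I3) ++ J) ->
  (forall z, z \in a :: rcons r1 u -> z \in b :: rcons r2 v -> False) ->
  size s <= (size I2).*2.
Proof.
move=> sym [cC max] cs sC us vs e1 u1 e2 u2 rs dis.
have uv : u != v.
  by apply/eqP => E; apply: (dis u); rewrite ?E inE mem_rcons mem_head orbT.
have [q [eq uq sq zq]] := long_arc sym cs us vs uv.
pose C := (I1 ++ a :: I2 ++ b :: I3) ++ J.
have rotC : rot (size I1) C = a :: I2 ++ b :: I3 ++ J ++ I1.
  by rewrite /C -?catA rot_size_cat -?catA /= -?catA /= -?catA.
have mC z : (z \in C) = (z \in a :: I2 ++ b :: I3 ++ J ++ I1).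
  by rewrite -rotC mem_rot.
have lC : longest_cycle e (a :: I2 ++ b :: I3 ++ J ++ I1).
  by rewrite -rotC; split; [rewrite rot_ucycle | move=> s' /max; rewrite size_rot].
suff le : size (r1 ++ u :: q ++ v :: rev r2) <= size I2.
  by move: le zq; rewrite size_cat /= size_cat /= size_rev -!addnn; lia.
apply: (ear_replacement lC).
- rewrite rcons_cat rcons_cons rcons_cat rcons_cons -cat_rcons cat_path e1 last_rcons /=.
  rewrite -cat_rcons cat_path eq last_rcons.
  have := e2; rewrite -(eq_path (e := fun x y => e y x)) //.
  by rewrite -rev_path last_rcons belast_rcons rev_cons.
- move: u1 u2; rewrite /= !rcons_uniq !mem_rcons !inE.
  rewrite !negb_or => /andP[_ /andP[ur1 u1]] /andP[_ /andP[vr2 u2]].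
  have qin z : z \in q -> [/\ z \in s, z != u & z != v].
    by move/sq; rewrite !inE negb_or => /andP[/andP[-> ->] ->].
  rewrite cat_uniq u1 /= cat_uniq uq /= rev_uniq u2 !andbT mem_rev vr2 /=.
  rewrite !mem_cat !inE mem_rev !negb_or uv /=.
  have ns z : z \in r1 ++ r2 -> z \notin s by case/rs.
  have nr z : z \in s -> z \notin r1 ++ r2 by move=> zs; apply: contraL zs; exact: ns.
  apply/and4P; split=> //.
  + apply/andP; split; first exact: ur1.
    apply/hasPn => z; rewrite mem_cat inE mem_rev => /or3P[zq'|/eqP->|zr2].
    * have [zs _ _] := qin _ zq'; by have := nr _ zs; rewrite mem_cat => /norP[].
    * by have := nr _ vs; rewrite mem_cat => /norP[].
    * apply/negP => zr1; apply: (dis z); 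
      by rewrite inE mem_rcons inE ?zr1 ?zr2 !orbT.
  + apply/andP; split; first by apply/negP => /qin []; rewrite eqxx.
    by have := nr _ us; rewrite mem_cat => /norP[].
  apply/andP; split; first by apply/negP => /qin []; rewrite eqxx.
  apply/hasPn => z; rewrite mem_rev => zr2; apply/negP => /qin [zs _ _].
  by have := nr _ zs; rewrite mem_cat zr2 orbT.
- move=> z zr; rewrite -mC.
  have : [|| z \in r1, z == u, z \in q, z == v | z \in r2].
    by move: zr; rewrite !(mem_cat, inE) mem_rev.
  case/or4P => [zr1|/eqP->|zq'|/orP[/eqP->|zr2]].
  + by case: (rs z); rewrite ?mem_cat ?zr1.
  + exact: sC.
  + by apply: sC; move/sq: zq'; rewrite !inE => /andP[].
  + exact: sC.
  + by case: (rs z); rewrite ?mem_cat ?zr2 ?orbT.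
Qed.

Definition avoiding e (P : pred T) : rel T := fun u v => e u v && ~~ P v.

Lemma path_avoiding e (P : pred T) x p :
  path (avoiding e P) x p = path e x p && all (predC P) p.
Proof.
elim: p x => //= y p IH x; rewrite IH /avoiding; case: (e x y) => //=.
by case: (path e y p); rewrite ?andbF.
Qed.

(** Two disjoint paths from [I] to [s] avoiding [J] would give an ear through
    [s] with more than [size I] inner vertices, so Menger's theorem leaves only
    a separating vertex. *)
Lemma arc_separator e I J s : symmetric e -> longest_cycle e (I ++ J) ->
  ucycle e s -> (size I).*2 < size s -> (forall z, z \in s -> z \notin I ++ J) ->
  exists t, forall x p, x \in I -> path e x p -> {in p, forall z, z \notin J} ->
    last x p \in s -> t \in x :: p.
Proof.
move=> sym lC cs zs sC.
have [t0 _] : exists t0, t0 \in s.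
  by case: s zs {cs sC} => // t0 s' _; exists t0; apply: mem_head.
pose e' := avoiding e (mem J).
have [ins|/existsNP [t /forallNP tsep]] :=
    EM (inseparable e' [set z in I] [set z in s]); last first.
  exists t => x p xI ep pJ lp; apply/negPn/negP => tp; apply: (tsep x); exists p.
  by split=> //; rewrite /walk !inE xI path_avoiding ep lp /= andbT; apply/allP.
have IS : [disjoint [set z in I] & [set z in s]].
  apply/pred0P => z /=; rewrite !inE; apply/andP => -[zI /sC].
  by rewrite mem_cat zI.
have [x [p [y [q [wp _ wq _ dis]]]]] := menger2 t0 ins.
have [a [r1 [u [aI us er1 [ur1 sr1] av1]]]] := walk_trim IS wp.
have [b [r2 [v [bI vs er2 [ur2 sr2] av2]]]] := walk_trim IS wq.
rewrite !inE in aI us bI vs.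
move: er1 er2; rewrite !path_avoiding => /andP[er1 /allP J1] /andP[er2 /allP J2].
have {}dis z : z \in a :: rcons r1 u -> z \in b :: rcons r2 v -> False.
  by move=> /sr1 zp /sr2; apply: dis.
have avoid z : z \in r1 ++ r2 -> z \notin s /\ z \notin I ++ J.
  rewrite !mem_cat negb_or => /orP[zr|zr].
    have := av1 _ zr; have := J1 z; rewrite mem_rcons inE zr orbT /= => /(_ isT) ->.
    by rewrite !inE negb_or => /andP[-> ->].
  have := av2 _ zr; have := J2 z; rewrite mem_rcons inE zr orbT /= => /(_ isT) ->.
  by rewrite !inE negb_or => /andP[-> ->].
have ab : a != b by apply/eqP => E; apply: (dis a); rewrite ?E mem_head.
(* The roles of [a] and [b] depend on which of them comes first on [I]. *)
case/splitPr: aI bI lC zs sC avoid {IS ins av1 av2} => I1 I2.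
rewrite mem_cat inE eq_sym (negPf ab) /= => /orP[] /splitPr [K1 K2] lC zs sC avoid.
  have eqI : (K1 ++ b :: K2) ++ a :: I2 = K1 ++ b :: K2 ++ a :: I2.
    by rewrite -catA.
  rewrite eqI in lC sC avoid zs.
  have avoid' z : z \in r2 ++ r1 ->
      z \notin s /\ z \notin (K1 ++ b :: K2 ++ a :: I2) ++ J.
    by rewrite mem_cat orbC -mem_cat => /avoid.
  have H := @ear_through_cycle e K1 K2 I2 J s b r2 v a r1 u sym lC cs sC vs us
    er2 ur2 er1 ur1 avoid' (fun z zb za => dis z za zb).
  by move: zs H; rewrite !size_cat /= size_cat /=; lia.
have H := @ear_through_cycle e I1 K1 K2 J s a r1 u b r2 v sym lC cs sC us vs
  er1 ur1 er2 ur2 avoid dis.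
by move: zs H; rewrite !size_cat /= size_cat /=; lia.
Qed.

(** * Sparsity of graphs without long cycles *)

Lemma split_last (a : pred T) p : has a p ->
  exists p1 y p2, [/\ p = rcons p1 y ++ p2, a y & ~~ has a p2].
Proof.
elim: p => //= x p IH; case: (boolP (has a p)) => [/IH [p1 [y [p2 [-> ay np2]]]] _|np].
  by exists (x :: p1), y, p2.
by rewrite orbF => ax; exists [::], x, p.
Qed.

(** All neighbours in [W] of the first vertex of a longest path in [W] lie on
    the path; closing the path at the last of them gives the cycle. *)
Lemma min_degree_cycle e W k : symmetric e -> irreflexive e -> W != set0 ->
  {in W, forall x, k <= #|[set y in W | e x y]|} -> 1 < k ->
  exists s, [/\ ucycle e s, k < size s & {subset s <= W}].
Proof.
move=> sym irr /set0Pn [w wW] deg k1.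
pose P := [pred s | [&& sorted e s, uniq s & all (mem W) s]].
have [||s /and3P[es us sW] max] := @longest_exists P [:: w].
- by rewrite /= wW.
- by move=> s /and3P[].
case: s es us sW max => [|x p] /= ep.
  by move=> _ _ /(_ [:: w]); rewrite /= wW => /(_ isT).
case/andP=> xp up /andP[xW /allP pW] max.
have Np : {subset [set y in W | e x y] <= p}.
  move=> y; rewrite inE => /andP[yW exy]; apply: contraT => yp.
  have := max [:: y, x & p]; rewrite /= sym exy ep up xp inE (negPf yp) orbF yW xW.
  rewrite ltnn => H; have xy : y != x by apply: contraTneq exy => ->; rewrite irr.
  by rewrite xy in H; apply: H; apply/allP.
have sz s : {subset [set y in W | e x y] <= s} -> k <= size s.
  move=> Ns; apply: leq_trans (deg x xW) _; rewrite cardE.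
  by apply: uniq_leq_size (enum_uniq _) _ => y; rewrite mem_enum => /Ns.
have hasN : has (e x) p.
  have : 0 < #|[set y in W | e x y]| by apply: leq_trans (deg x xW); apply: ltnW.
  case/card_gt0P => y yN; apply/hasP; exists y; first by rewrite Np.
  by move: yN; rewrite inE => /andP[].
have {hasN} [q1 [y [q2 [Ep exy nq2]]]] := split_last hasN.
have Nq : {subset [set y in W | e x y] <= rcons q1 y}.
  move=> z zN; have := Np z zN; rewrite Ep mem_cat => /orP[//|zq].
  by case/negP: (hasPn nq2 z zq); move: zN; rewrite inE => /andP[].
exists (x :: rcons q1 y); split.
- rewrite Ep in ep up xp.
  move: ep up xp; rewrite cat_path cat_uniq mem_cat negb_or.
  move=> /andP[eq _] /andP[uq _] /andP[xq _].
  by rewrite /ucycle /= rcons_path eq last_rcons sym exy xq uq.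
- by rewrite ltnS; apply: sz Nq.
- move=> z; rewrite inE => /orP[/eqP->//|zq]; apply: pW.
  by rewrite Ep mem_cat zq.
Qed.

(** By [min_degree_cycle] some vertex of [W] has fewer than [k] neighbours in
    [W]; remove it and repeat. *)
Lemma sparse_of_no_long_cycle e k : symmetric e -> irreflexive e -> 1 < k ->
  forall W, (forall s, ucycle e s -> {subset s <= W} -> size s <= k) ->
  #|arcs (fun x y => [&& e x y, x \in W & y \in W])| <= k.*2 * #|W|.
Proof.
move=> sym irr k1 W; have [n] := ubnP #|W|; elim: n W => // n IH W le_n noC.
have [->|W0] := eqVneq W set0.
  by rewrite (@eq_card0 _ (arcs _)) // => -[x y]; rewrite !inE !andbF.
case: (boolP [forall x in W, k <= #|[set y in W | e x y]|]) => [/forall_inP deg|].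
  have [s [cs lt sW]] := min_degree_cycle sym irr W0 deg k1.
  by have := noC s cs sW; rewrite leqNgt lt.
rewrite negb_forall_in => /existsP [v /andP[vW]]; rewrite -ltnNge => dv.
set A := arcs _.
have le_A : #|arcs (fun x y => [&& e x y, x \in W :\ v & y \in W :\ v])|
    <= k.*2 * #|W :\ v|.
  apply: IH => [|s cs sW]; first by rewrite (cardsD1 v) vW in le_n.
  by apply: noC => // z /sW; rewrite inE => /andP[].
set N := [set y in W | e v y] in dv.
have sub : A \subset arcs (fun x y => [&& e x y, x \in W :\ v & y \in W :\ v])
   :|: ([set (v, y) | y in N] :|: [set (y, v) | y in N]).
  apply/subsetP => -[x y]; rewrite !inE /= => /and3P[exy xW yW].
  have [Ex|xv] := eqVneq x v.
    by rewrite Ex in exy *; rewrite (imset_f (fun y => (v, y))) ?orbT // inE yW.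
  have [Ey|yv] := eqVneq y v.
    rewrite Ey sym in exy *; rewrite (imset_f (fun y => (y, v))) ?orbT //.
    by rewrite inE xW.
  by rewrite exy xW yW.
apply: leq_trans (subset_leq_card sub) _.
apply: leq_trans (leq_card_setU _ _) _.
rewrite [#|W|](cardsD1 v) vW mulnDr addnC muln1; apply: leq_add le_A.
apply: leq_trans (leq_card_setU _ _) _; rewrite -addnn.
by apply: leq_add; apply: leq_trans (leq_imset_card _ _) (ltnW dv).
Qed.

(** * Separating the longest cycle from another long cycle *)

(** The arcs of [c] of [L] vertices starting at the multiples of [L] cover [c];
    take for each the vertex given by [arc_separator].  The last vertex on [c]
    of a path to [s] lies in one of these arcs, and from there on the path
    avoids the rest of [c]. *)
Lemma cycle_separator e c s k L : symmetric e -> longest_cycle e c ->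
  ucycle e s -> (forall z, z \in s -> z \notin c) ->
  size c <= k * L -> L.*2 < size s ->
  exists S, #|S| <= k /\ forall x p, x \in c -> path e x p -> last x p \in s ->
    exists2 z, z \in S & z \in x :: p.
Proof.
move=> sym [cc max] cs sc le_c lt_s.
pose I (j : 'I_k) := take L (rot (j * L) c).
pose J (j : 'I_k) := drop L (rot (j * L) c).
have IJ j : I j ++ J j = rot (j * L) c by apply: cat_take_drop.
have /fin_all_exists [f fP] (j : 'I_k) : exists t, forall x p, x \in I j ->
    path e x p -> {in p, forall z, z \notin J j} -> last x p \in s -> t \in x :: p.
  apply: (arc_separator sym _ cs).
  - by rewrite IJ; split; [rewrite rot_ucycle | move=> s' /max; rewrite size_rot].
  - apply: leq_ltn_trans lt_s; rewrite leq_double size_take.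
    by case: ltnP.
  - by move=> z /sc; rewrite IJ mem_rot.
exists [set f j | j : 'I_k]; split.
  by apply: leq_trans (leq_imset_card _ _) _; rewrite card_ord.
move=> x p xc ep lp.
have cs0 : [disjoint [set z in c] & [set z in s]].
  by apply/pred0P => z /=; rewrite !inE; apply/andP => -[zc /sc]; rewrite zc.
have wp : walk e [set z in c] [set z in s] x p by rewrite /walk !inE xc ep lp.
have [a [r [u [ac us er [ur sr] av]]]] := walk_trim cs0 wp.
rewrite !inE in ac us.
have ia : index a c < size c by rewrite index_mem.
have L0 : 0 < L by case: L le_c {lt_s I J IJ f fP}; lia.
have jk : index a c %/ L < k by rewrite ltn_divLR //; lia.
have aI : a \in I (Ordinal jk).
  have Ei := divn_eq (index a c) L; have Em := ltn_pmod (index a c) L0.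
  have zd : index a c %% L < size (drop (index a c %/ L * L) c).
    by rewrite size_drop; lia.
  have Ea : nth a (I (Ordinal jk)) (index a c %% L) = a.
    by rewrite /I nth_take // /rot nth_cat zd nth_drop -Ei nth_index.
  rewrite -{1}Ea; apply: mem_nth; rewrite size_take /rot size_cat.
  by case: ifP => // _; apply: leq_trans zd (leq_addr _ _).
exists (f (Ordinal jk)); first exact: imset_f.
apply/sr/(fP _ _ _ aI er); last by rewrite last_rcons.
move=> z; rewrite mem_rcons inE => zur; apply/negP => /mem_drop; rewrite mem_rot.
case/orP: zur => [/eqP->|/av]; first exact/negP/sc.
by rewrite !inE negb_or => /andP[/negP].
Qed.

(** * Decompositions *)

Definition induced_rel e A : rel T := fun x y => [&& e x y, x \in A & y \in A].

(** The components of [h] have vertex covers of order at most [d]; quantifying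
    over a vertex [x] of the component makes the property pass to subgraphs of
    [h] and to disjoint unions. *)
Definition covered d h := forall x, exists2 S : {set T}, #|S| <= d
  & forall u v, connect h x u -> h u v -> (u \in S) || (v \in S).

(** [h] is what remains of [e].  The summand [k.*2 * m] pays in advance for
    detaching [k] vertices, which are incident with at most [k * m] arcs of [h]
    in each direction. *)
Definition decomposes d k e h m N :=
  [/\ symmetric h, subrel h e, forall x, #|[set y | h x y]| <= m, covered d h
    & #|arcs e :\: arcs h| + k.*2 * m <= N].

Lemma card_arcs_at h S m : (forall x, #|[set y | h x y]| <= m) ->
  #|[set a in arcs h | a.1 \in S]| <= #|S| * m.
Proof.
move=> deg; rewrite -sum1_card -sum_nat_const.
have -> : \sum_(a in [set a in arcs h | a.1 \in S]) 1 =
    \sum_(x in S) \sum_(y | h x y) 1.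
  by rewrite pair_big_dep; apply: eq_bigl => -[x y]; rewrite !inE andbC.
by apply: leq_sum => x _; apply: leq_trans (deg x); rewrite -sum1_card; 
  apply/eq_leq/eq_bigl => y; rewrite inE.
Qed.

Lemma connect_invariant h (g : rel T) (P : pred T) x u :
  (forall v w, P v -> h v w -> P w /\ g v w) -> P x -> connect h x u ->
  P u /\ connect g x u.
Proof.
move=> step Px /connectP [p hp ->] {u}.
elim: p x Px hp => [|y p IH] x Px /=; first by rewrite connect0.
case/andP=> hxy hp; have [Py gxy] := step _ _ Px hxy.
have [Pl cl] := IH y Py hp; split=> //.
exact: connect_trans (connect1 gxy) cl.
Qed.

(** Detach [A :&: B] from the side [A], where the degrees are smaller: the arcs
    lost are paid for by the term [k.*2 * mA], and [k.*2 * mB] remains for the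
    whole. *)
Lemma combine d k e A B hA hB mA mB NA NB :
  #|A :&: B| <= k ->
  (forall x y, e x y -> (x \in A) && (y \in A) || (x \in B) && (y \in B)) ->
  decomposes d k (induced_rel e A) hA mA NA ->
  decomposes d k (induced_rel e B) hB mB NB -> mA <= mB ->
  exists h, decomposes d k e h mB (NA + NB).
Proof.
move=> leS eAB [symA subA degA covA costA] [symB subB degB covB costB] le_m.
pose h : rel T := fun x y => hB x y || [&& hA x y, x \notin B & y \notin B].
have hBin x y : hB x y -> (x \in B) && (y \in B) by move/subB/and3P=> [_ -> ->].
have h_in x y : x \in B -> h x y -> y \in B /\ hB x y.
  by move=> xB; rewrite /h xB /= andbF orbF => hxy; case/andP: (hBin _ _ hxy).
have h_out x y : x \notin B -> h x y -> y \notin B /\ hA x y.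
  move=> xB; rewrite /h xB /=; case: (boolP (hB x y)) => [/hBin|_ /andP[-> ->] //].
  by rewrite (negPf xB).
exists h; split.
- by move=> x y; rewrite /h symB symA [(x \notin B) && _]andbC.
- by move=> x y /orP[/subB/and3P[]|/andP[/subA/and3P[]]].
- move=> x; case: (boolP (x \in B)) => xB.
    apply: leq_trans (degB x); apply/subset_leq_card/subsetP => y; rewrite !inE.
    by case/(h_in _ _ xB).
  apply: leq_trans le_m; apply: leq_trans (degA x).
  apply/subset_leq_card/subsetP => y; rewrite !inE.
  by case/(h_out _ _ xB).
- move=> x; case: (boolP (x \in B)) => xB.
    have [S leSd SP] := covB x; exists S => // u v xu huv.
    have [uB xu'] := connect_invariant h_in xB xu.
    by apply: SP => //; case: (h_in _ _ uB huv).
  have [S leSd SP] := covA x; exists S => // u v xu huv.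
  have [uB xu'] := connect_invariant (P := [pred z | z \notin B]) h_out xB xu.
  by apply: SP => //; case: (h_out _ _ uB huv).
(* The arcs of [hA] leaving [A :&: B], and those entering it, reversed. *)
pose E1 := [set a in arcs hA | a.1 \in A :&: B].
pose E2 := [set a in arcs (fun x y => hA y x) | a.1 \in A :&: B].
have swapK : involutive (fun a : T * T => (a.2, a.1)) by case.
have c1 : #|E1| <= k * mA.
  by apply: leq_trans (card_arcs_at _ degA) _; rewrite leq_mul2r leS orbT.
have c2 : #|E2| <= k * mA.
  apply: leq_trans (@card_arcs_at _ _ mA _) _; last by rewrite leq_mul2r leS orbT.
  move=> x; apply: leq_trans (degA x); apply/subset_leq_card/subsetP => y.
  by rewrite !inE symA.
have sub : arcs e :\: arcs h \subset
   ((arcs (induced_rel e A) :\: arcs hA) :|: (arcs (induced_rel e B) :\: arcs hB))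
   :|: (E1 :|: (fun a => (a.2, a.1)) @: E2).
  apply/subsetP => -[x y]; rewrite in_setD 2!inE /= => /andP[nh exy].
  move: nh; rewrite /h negb_or => /andP[nB nA].
  rewrite !in_setU !in_setD.
  have -> : ((x, y) \in [set (a.2, a.1) | a in E2]) = ((y, x) \in E2).
    exact: (mem_imset E2 (y, x) (inv_inj swapK)).
  rewrite !inE /= /induced_rel exy (negPf nB) /=.
  case/orP: (eAB _ _ exy) => /andP[xP yP]; rewrite xP yP ?orbT //=.
  by move: nA; case: (hA x y) => //=; case: (x \in B); case: (y \in B).
have c2' := leq_trans (leq_imset_card (fun a => (a.2, a.1)) E2) c2.
apply: leq_trans (leq_add costA costB); rewrite addnACA addnA leq_add2r -addnn mulnDl.
have c12 := leq_trans (leq_card_setU _ _) (leq_add c1 c2').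
apply: leq_trans (leq_add (leqnn _) c12).
have := leq_trans (subset_leq_card sub) (leq_card_setU _ _).
move/leq_trans; apply; rewrite leq_add2r; exact: leq_card_setU.
Qed.

Lemma decomposes_le d k e h m N N' :
  N <= N' -> decomposes d k e h m N -> decomposes d k e h m N'.
Proof. by move=> le [? ? ? ? le']; split=> //; apply: leq_trans le. Qed.

(** Induction on [#|W|].  The allowance counts [#|W| - k] so as to be
    superadditive when the sides overlap in [k] vertices; as [#|W| >= 2k] this
    is still at least half of [#|W|], which suffices when nothing is split. *)
Lemma decomposition d k L e W : 0 < L -> k <= L -> d <= k * L ->
  symmetric e -> irreflexive e -> (forall x y, e x y -> x \in W) ->
  (forall s, ucycle e s -> size s < d) -> k.*2 <= #|W| ->
  exists h m, decomposes d k e h m (4 * (L.*2 + k) * (#|W| - k)).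
Proof.
move=> L0 kL dkL; have [n] := ubnP #|W|; elim: n e W => // n IH e W le_n.
move=> sym irr eW noC leW.
have [||c cc max] := @longest_exists (ucycleb e) [::] => //.
  by move=> s /andP[].
have max' s : ucycle e s -> size s <= size c by move=> us; apply: max.
have lc : longest_cycle e c by [].
have cd : size c < d by apply: noC.
(* Either there is a second long cycle, or deleting all edges off [c] is cheap. *)
have [[s [cs ls sc]]|noS] := EM (exists s, [/\ ucycle e s, L.*2 < size s
   & forall z, z \in s -> z \notin c]); last first.
  pose h x y := e x y && ((x \in c) || (y \in c)).
  exists h, #|W|; split.
  - by move=> x y; rewrite /h sym orbC.
  - by move=> x y /andP[].
  - move=> x; apply/subset_leq_card/subsetP => y; rewrite inE => /andP[exy _].
    by move: exy; rewrite sym => /eW.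
  - move=> x; exists [set z in c]; last by move=> u v _ /andP[_]; rewrite !inE.
    apply: leq_trans (ltnW cd); rewrite cardE; apply: uniq_leq_size (enum_uniq _) _.
    by move=> z; rewrite mem_enum inE.
  have k1 : 1 < L.*2 by lia.
  have := @sparse_of_no_long_cycle e _ sym irr k1 (W :\: [set z in c]).
  have noc s : ucycle e s -> {subset s <= W :\: [set z in c]} -> size s <= L.*2.
    move=> us sW; rewrite leqNgt; apply/negP => lt; apply: noS; exists s.
    by split=> // z /sW; rewrite !inE => /andP[].
  move/(_ noc) => le1.
  have le2 : #|arcs e :\: arcs h| <= (L.*2).*2 * #|W|.
    apply: leq_trans (leq_trans le1 _); last first.
      by rewrite leq_mul2l subset_leq_card ?orbT // subsetDl.
    apply/subset_leq_card/subsetP => -[x y]; rewrite !inE /h /= => /andP[nh exy].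
    move: nh; rewrite exy negb_or => /andP[-> ->]; rewrite (eW _ _ exy).
    by move: exy; rewrite sym => /eW ->.
  nia.
have [S [leS sepS]] := cycle_separator sym lc cs sc (leq_trans (ltnW cd) dkL) ls.
have cycW s' : ucycle e s' -> {subset s' <= W}.
  by move=> /andP[cy _] z zs; apply: eW (next_cycle cy zs).
(* [R] is the part of the graph beyond [S] on the side of the cycle [s]. *)
pose eS := avoiding e (mem S).
pose R := [set y | (y \notin S) && [exists z in s, connect eS y z]].
have cR z : z \in c -> z \notin R.
  move=> zc; rewrite inE; apply/andP => -[zS /exists_inP [w ws /connectP [p]]].
  rewrite path_avoiding => /andP[ep /allP pS] Ew; rewrite {}Ew in ws.
  have [t tS] := sepS z p zc ep ws; rewrite inE => /orP[/eqP Et|/pS /=].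
    by rewrite -Et tS in zS.
  by rewrite tS.
have sR z : z \in s -> z \in R :|: S.
  move=> zs; rewrite !inE; case: (z \in S) => //=; rewrite orbF.
  by apply/exists_inP; exists z => //; apply: connect0.
have R_closed x y : x \in R -> e x y -> y \in R :|: S.
  rewrite !inE => /andP[xS /exists_inP [z zs xz]] exy.
  case: (boolP (y \in S)) => //= _; rewrite orbF; apply/exists_inP; exists z => //.
  by apply: connect_trans xz; apply: connect1; rewrite /eS /avoiding sym exy.
pose A := W :\: R; pose B := W :&: (R :|: S).
have RS x : x \in R -> x \notin S by rewrite inE => /andP[].
have AB : #|A :&: B| <= k.
  apply: leq_trans leS; apply/subset_leq_card/subsetP => x.
  by rewrite !in_setI in_setD in_setU => /andP[/andP[/negPf -> _]] /andP[].
have ABW : #|A| + #|B| <= #|W| + k.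
  rewrite -cardsUI leq_add // subset_leq_card // subUset subsetDl subsetIl //.
have eAB x y : e x y -> (x \in A) && (y \in A) || (x \in B) && (y \in B).
  move=> exy; have xW := eW _ _ exy.
  have eyx : e y x by rewrite sym.
  have yW := eW _ _ eyx; rewrite /A /B !in_setD !in_setI !in_setU xW yW !andbT /=.
  have := R_closed x y; have := R_closed y x; rewrite !in_setU exy eyx.
  case: (x \in R); case: (y \in R) => //=; first by move=> _ /(_ isT isT).
  by move=> /(_ isT isT) ->.
have lc2 : L.*2 < size c by apply: leq_trans ls (max' _ cs).
have uc : uniq c by case/andP: cc.
have us : uniq s by case/andP: cs.
have card_ge (s' : seq T) X : uniq s' -> {subset s' <= X} -> size s' <= #|X|.
  by move=> us' sX; rewrite cardE; apply: uniq_leq_size => // z /sX; rewrite mem_enum.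
have cA : {subset c <= A}.
  move=> z zc; rewrite in_setD cR //=; exact: cycW zc.
have sB : {subset s <= B}.
  move=> z zs; rewrite in_setI sR // andbT; exact: cycW zs.
have leA := card_ge _ _ uc cA; have leB := card_ge _ _ us sB.
have sub_ind X : subrel (induced_rel e X) e by move=> x y /and3P[].
have rec X : #|X| < #|W| -> k.*2 <= #|X| -> exists (h : rel T) m,
    decomposes d k (induced_rel e X) h m (4 * (L.*2 + k) * (#|X| - k)).
  move=> ltX leX; apply: IH => //.
  - by apply: leq_trans ltX _; rewrite -ltnS.
  - by move=> x y; rewrite /induced_rel sym [(x \in X) && _]andbC.
  - by move=> x; rewrite /induced_rel irr.
  - by move=> x y /and3P[].
  by move=> s' /andP[cy us']; apply: noC; rewrite /ucycle us' (sub_cycle (sub_ind X)).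
have [ltA kA] : #|A| < #|W| /\ k.*2 <= #|A| by lia.
have [ltB kB] : #|B| < #|W| /\ k.*2 <= #|B| by lia.
have [hA [mA dA]] := rec A ltA kA.
have [hB [mB dB]] := rec B ltB kB.
have final : 4 * (L.*2 + k) * (#|A| - k) + 4 * (L.*2 + k) * (#|B| - k) <=
   4 * (L.*2 + k) * (#|W| - k) by rewrite -mulnDr leq_mul2l; apply/orP; right; lia.
have [le_m|/ltnW le_m] := leqP mA mB.
  have [h hP] := combine AB eAB dA dB le_m; exists h, mB.
  exact: decomposes_le final hP.
have BA : #|B :&: A| <= k by rewrite setIC.
have eBA x y : e x y -> (x \in B) && (y \in B) || (x \in A) && (y \in A).
  by rewrite orbC; apply: eAB.
have [h hP] := combine BA eBA dB dA le_m.
exists h, mA; apply: decomposes_le hP; by rewrite addnC.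
Qed.

End Relations.

(** * From relations back to graphs *)

Lemma covered_del_edges (G : sgraph) (F : {set {set G}}) (h : rel G) d :
  (forall x y, del_adj F x y -> h x y) -> covered d h ->
  forall C : {set del_edges F}, C \in components (del_edges F) ->
  exists S : {set induced C}, vertex_cover S /\ #|S| <= d.
Proof.
move=> Fh cov C /imsetP [x _ ->].
have [S leS SP] := cov x.
exists [set v | val v \in S]; split; last first.
  apply: leq_trans leS; rewrite -(card_imset _ val_inj).
  apply/subset_leq_card/subsetP => y /imsetP [v]; rewrite inE => vS ->.
  exact: vS.
move=> E /imsetP [[u v]]; rewrite inE /= => uv ->{E}.
have xu : connect h x (val u).
  have : val u \in [set y | connect (adj (s := del_edges F)) x y] by apply: valP.
  rewrite inE; apply: connect_sub => a b ab; apply: connect1; exact: Fh.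
apply/set0Pn; have /orP[uS|vS] := SP _ _ xu (Fh _ _ uv).
  by exists u; rewrite !inE uS eqxx.
by exists v; rewrite !inE vS eqxx orbT.
Qed.

(** With [L] about [d / 16N] and [k = 32N], the allowance [4 * (2L + k)] per
    vertex is [d / 2N] up to a constant, and [512 * N ^ 2 <= d] makes that
    constant negligible.  A graph with fewer than [2k] vertices is its own
    cover. *)
Lemma decomposition_of_graph N d (G : sgraph) : 0 < N -> 512 * N ^ 2 <= d ->
  (forall s, ucycle (@adj G) s -> size s < d) ->
  exists h : rel G, [/\ covered d h & N * #|arcs (@adj G) :\: arcs h| <= d * #|G|].
Proof.
move=> N0 le_d noC; set L := d %/ (16 * N); set k := 32 * N.
have [small|large] := ltnP #|G| k.*2.
  exists (@adj G); split; last by rewrite setDv cards0 muln0.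
  move=> x; exists setT => [|u v _ _]; last by rewrite inE.
  rewrite cardsT; apply: leq_trans (ltnW small) _; rewrite /k; nia.
have N16 : 0 < 16 * N by lia.
have Ld : L * (16 * N) <= d by apply: leq_trunc_div.
have dL : d < L.+1 * (16 * N) by rewrite ltn_ceil.
have kL : k <= L by rewrite leq_divRL // /k; nia.
have L0 : 0 < L by apply: leq_trans kL; rewrite /k; lia.
have dkL : d <= k * L by rewrite /k; nia.
have [|h [m [_ _ _ cov cost]]] := @decomposition G d k L (@adj G) setT L0 kL dkL
    (@adj_sym G) (@adj_irrefl G) (fun x y _ => in_setT x) noC.
  by rewrite cardsT.
exists h; split=> //; rewrite cardsT in cost.
have le1 : #|arcs (@adj G) :\: arcs h| <= 4 * (L.*2 + k) * #|G|.
  apply: leq_trans (leq_trans (leq_addr _ _) cost) _.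
  by rewrite leq_mul2l leq_subr orbT.
apply: leq_trans (leq_mul (leqnn N) le1) _; rewrite mulnA leq_mul2r; apply/orP; right.
rewrite /k -muln2; nia.
Qed.

Local Open Scope ring_scope.

Theorem theorem1p2 (R : realType) (c : R) (hc : 0 < c) :
  exists d0 : nat, forall d : nat, (d0 <= d)%N ->
  forall (n : nat) (G : sgraph), #|G| = n ->
    (exists s : seq G, graph_cycle s /\ (d <= size s)%N) \/
    (exists F : {set {set G}},
       [/\ F \subset edges G,
           #|F|%:R <= c * d%:R * n%:R
         & forall C : {set del_edges F}, C \in components (del_edges F) ->
           exists S : {set induced C}, vertex_cover S /\ (#|S| <= d)%N]).
Proof.
pose N := (Num.bound c^-1).+1.
have Nc : 1 <= c * N%:R.
  rewrite -ler_pdivrMl // mulr1; apply: ltW.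
  apply: lt_trans (archi_boundP _) _; first by rewrite invr_ge0 ltW.
  by rewrite ltr_nat.
exists (512 * N ^ 2)%N => d le_d n G <-.
have [[s cs]|noC] := EM (exists s : seq G, graph_cycle s /\ (d <= size s)%N).
  by left; exists s.
right.
have {}noC s : ucycle (@adj G) s -> (size s < d)%N.
  move=> us; rewrite ltnNge; apply/negP => ds; apply: noC; exists s.
  by split=> //; split=> //; apply: leq_trans ds; apply: leq_trans le_d; lia.
have [h [cov cost]] := decomposition_of_graph (isT : (0 < N)%N) le_d noC.
pose X := arcs (@adj G) :\: arcs h.
exists [set [set p.1; p.2] | p in X]; split.
- by apply/imsetS/subsetP => p; rewrite !inE => /andP[].
- rewrite -[X in X <= _]mul1r; apply: le_trans (_ : c * N%:R * #|X|%:R <= _).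
    by apply: ler_pM => //; rewrite ler_nat leq_imset_card.
  rewrite -!mulrA ler_pM2l // -!natrM ler_nat; exact: cost.
apply: covered_del_edges cov => x y /andP[xy]; apply: contraR => nh.
by apply/imsetP; exists (x, y); rewrite // !inE xy nh.
Qed.
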